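(* Let $p$ be an odd prime, $n\ge 1$ an integer, and $F=\mathbb{F}_{p^n}$. Any monomial function $f_d\colon F\to F$, $f_d(x)=x^d$ (with $d<p^n$), of algebraic degree $n(p-1)-1$ is EA-equivalent to the inverse permutation $F\to F$, $x\mapsto x^{p^n-2}$. In particular, $f_d$ is a GAPN function on $F$.
   Context: A function $f\colon F\to F$, $F=\mathbb{F}_{p^n}$, is a generalized almost perfect nonlinear (GAPN) function if for all $a\in F^\times$ and $b\in F$, $$\#\Big\{x\in F : \sum_{i\in\mathbb{F}_p} f(x+ia)=b\Big\}\le p.$$ For $0\le d<p^n$ with $p$-adic expansion $d=\sum_{s=0}^{n-1}d_sp^s$ ($0\le d_s\le p-1$), the algebraic degree of $f_d(x)=x^d$ on $F$ equals the $p$-weight $w_p(d)=\sum_{s=0}^{n-1}d_s$. Two functions $f,g\colon F\to F$ are EA-equivalent (extended affine equivalent) if $g=A_1\circ f\circ A_2+A_3$ for some $\mathbb{F}_p$-affine bijections $A_1,A_2\colon F\to F$ and some $\mathbb{F}_p$-affine map $A_3\colon F\to F$. *)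

(* Defs.v *)
From mathcomp Require Import all_boot all_order all_algebra all_field.

Set Implicit Arguments.
Unset Strict Implicit.
Unset Printing Implicit Defensive.

Import GRing.Theory.
Local Open Scope ring_scope.

(* The prime field of a field F of characteristic p, as the image of 'F_p. *)
Definition prime_emb (p : nat) (F : finFieldType) (i : 'F_p) : F :=
  (nat_of_ord i)%:R.

Definition Fp_linear (p : nat) (F : finFieldType) (L : F -> F) : Prop :=
  (forall x y, L (x + y) = L x + L y) /\
  (forall (i : 'F_p) x, L (prime_emb F i * x) = prime_emb F i * L x).

Definition Fp_affine (p : nat) (F : finFieldType) (A : F -> F) : Prop :=
  exists L : F -> F, exists c : F, Fp_linear p L /\ forall x, A x = L x + c.

Definition EA_equivalent (p : nat) (F : finFieldType) (f g : F -> F) : Prop :=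
  exists A1 A2 A3 : F -> F,
    [/\ Fp_affine p A1 /\ bijective A1,
        Fp_affine p A2 /\ bijective A2,
        Fp_affine p A3
      & forall x, g x = A1 (f (A2 x)) + A3 x].

Definition GAPN (p : nat) (F : finFieldType) (f : F -> F) : Prop :=
  forall a b : F, a != 0 ->
    (#|[set x : F | (\sum_(i : 'F_p) f (x + prime_emb F i * a) == b)%R]| <= p)%N.

Definition p_weight (p n d : nat) : nat :=
  (\sum_(s < n) (d %/ p ^ s) %% p)%N.

(* The unique polynomial of degree < #|F| inducing f; see reduced_polyP. *)
Definition reduced_poly (F : finFieldType) (f : F -> F) : {poly F} :=
  \sum_(a : F) f a *: (1 - ('X - a%:P) ^+ #|F|.-1).

(* For f(x) = \sum_(d < p ^ n) c_d x ^ d on the field with p ^ n elements, the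
   algebraic degree is the largest p-weight of an exponent d with c_d != 0
   (and 0 for f = 0). *)
Definition alg_degree (p n : nat) (F : finFieldType) (f : F -> F) : nat :=
  \max_(d < p ^ n | (reduced_poly f)`_d != 0) p_weight p n d.

Lemma reduced_polyP (F : finFieldType) (f : F -> F) (P : {poly F}) :
  P = reduced_poly f <-> (size P <= #|F|)%N /\ forall x, P.[x] = f x.
Proof.
have q_gt1 : (1 < #|F|)%N := finNzRing_gt1 F.
have hs : (size (reduced_poly f) <= #|F|)%N.
  apply: (leq_trans (size_sum _ _ _)); apply/bigmax_leqP => a _.
  apply: (leq_trans (size_scale_leq _ _)).
  apply: (leq_trans (size_polyD _ _)); rewrite geq_max size_poly1 size_polyN.
  have q0 := ltnW q_gt1; by rewrite size_exp_XsubC (prednK q0) q0 leqnn.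
have he x : (reduced_poly f).[x] = f x.
  rewrite horner_sum (bigD1 x) //= big1 => [|a ne_ax].
    rewrite !hornerE subrr expr0n; case: #|F| q_gt1 => [|[|q]] //= _.
    by rewrite subr0 mulr1.
  rewrite !hornerE.
  have nz : x - a != 0 by rewrite subr_eq0 eq_sym.
  have -> : (x - a) ^+ #|F|.-1 = 1.
    apply: (mulfI nz); rewrite -exprS prednK ?(ltnW q_gt1) //.
    by rewrite expf_card mulr1.
  by rewrite subrr mulr0.
split=> [->//|[hP eP]]; apply/eqP; rewrite -subr_eq0; apply/negPn/negP => nz.
have hr : all (root (P - reduced_poly f)) (enum F).
  by apply/allP => x _; rewrite rootE !hornerE eP he subrr.
have := max_poly_roots nz hr (enum_uniq F).
by rewrite -cardE ltnNge (leq_trans (size_polyD _ _)) // size_polyN geq_max hP hs.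
Qed.

Lemma alg_degree_monomial (p n : nat) (F : finFieldType) (d : nat) :
  #|F| = (p ^ n)%N -> (d < p ^ n)%N ->
  alg_degree p n (fun x : F => x ^+ d) = p_weight p n d.
Proof.
move=> cF hd; rewrite /alg_degree.
have <- : 'X^d = reduced_poly (fun x : F => x ^+ d).
  apply/reduced_polyP; rewrite size_polyXn cF; split=> // x.
  by rewrite hornerXn.
rewrite (big_pred1 (Ordinal hd)) // => i /=.
rewrite coefXn -[RHS]val_eqE /=; case: (_ == d); last by rewrite eqxx.
exact: oner_neq0.
Qed.

(* Main.v *)
(* An exponent d < p ^ n of p-weight n(p-1)-1 has all digits p-1 except one
   digit p-2, so d = p ^ n - 1 - p ^ k and x ^ d = (x^-1) ^ (p ^ k): a Frobenius
   power of inversion. For inversion, after scaling a to 1, the logarithmic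
   derivative of \prod_i (X - i) = X ^ p - X gives
   \sum_i (x + i)^-1 = - (x ^ p - x)^-1 for x outside the prime field, while the
   sum is 0 on it; with the convention 0^-1 = 0, the fibre over any b thus lies
   in the root set of X ^ p - X + b^-1. *)

Require Import Defs.
From mathcomp Require Import all_boot all_order all_algebra all_field.

Set Implicit Arguments.
Unset Strict Implicit.
Unset Printing Implicit Defensive.

Import GRing.Theory.
Local Open Scope ring_scope.

(** * Base-[p] digits of exponents of extremal weight *)

Lemma p_weightS (p n d : nat) :
  p_weight p n.+1 d = (d %% p + p_weight p n (d %/ p))%N.
Proof.
rewrite /p_weight big_ord_recl expn0 divn1; congr (_ + _)%N.
by apply: eq_bigr => i _; rewrite /= /bump add1n expnS divnMA.
Qed.

Lemma p_weight_le (p n d : nat) : (0 < p)%N -> (p_weight p n d <= n * p.-1)%N.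
Proof.
move=> p0; rewrite /p_weight -[X in (X * _)%N]card_ord -sum_nat_const.
by apply: leq_sum => i _; rewrite -ltnS prednK // ltn_mod.
Qed.

Lemma p_weight_max (p n d : nat) : (0 < p)%N -> (d < p ^ n)%N ->
  p_weight p n d = (n * p.-1)%N -> d.+1 = (p ^ n)%N.
Proof.
move=> p0; elim: n d => [|n IH] d; first by rewrite expn0; case: d.
rewrite p_weightS mulSn expnSr => hd hw.
have hq : (d %/ p < p ^ n)%N by rewrite ltn_divLR.
have hm : (d %% p <= p.-1)%N by rewrite -ltnS prednK // ltn_mod.
have hm' : (p.-1 <= d %% p)%N.
  by rewrite -(leq_add2r (n * p.-1)) -hw leq_add2l p_weight_le.
have em : (d %% p = p.-1)%N by apply/eqP; rewrite eqn_leq hm hm'.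
have eq : (d %/ p).+1 = (p ^ n)%N.
  by apply: IH => //; apply/eqP; rewrite -(eqn_add2l p.-1) -hw em.
by rewrite {1}(divn_eq d p) em -addnS prednK // addnC -mulSn eq.
Qed.

(** Induction on the lowest digit. If it is [p - 1], the deficit of one lies in a higher digit and
    [k] shifts by one; otherwise the bound on the quotient makes the higher digits maximal and the
    lowest digit [p - 2], so [k = 0]. *)
Lemma p_weight_submax (p n d : nat) : (0 < p)%N -> (d < p ^ n)%N ->
  (p_weight p n d).+1 = (n * p.-1)%N ->
  exists2 k, (k < n)%N & (d + p ^ k).+1 = (p ^ n)%N.
Proof.
move=> p0; elim: n d => [|n IH] d; first by rewrite mul0n.
rewrite p_weightS mulSn expnSr => hd hw.
have hq : (d %/ p < p ^ n)%N by rewrite ltn_divLR.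
have hm : (d %% p <= p.-1)%N by rewrite -ltnS prednK // ltn_mod.
have [em|nm] := eqVneq (d %% p)%N p.-1.
  have [||k lt_kn ek] := IH (d %/ p)%N => //.
    by apply/eqP; rewrite -(eqn_add2l p.-1) -hw em addnS.
  exists k.+1 => //.
  rewrite {1}(divn_eq d p) em -ek expnSr addnAC -addnS prednK //.
  by rewrite -mulnDl addnC -mulSn.
have lm : (d %% p < p.-1)%N by rewrite ltn_neqAle nm.
have lw := p_weight_le n (d %/ p) p0.
have ew : p_weight p n (d %/ p) = (n * p.-1)%N.
  apply/eqP; rewrite eqn_leq lw /= -(leq_add2l p.-1) -hw -addSn leq_add2r.
  exact: lm.
have em : (d %% p).+1 = p.-1.
  by apply/eqP; rewrite -(eqn_add2r (n * p.-1)) -hw ew.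
exists 0%N => //.
rewrite {1}(divn_eq d p) expn0 addn1 -2!addnS em prednK // addnC -mulSn.
by rewrite (p_weight_max p0 hq ew).
Qed.

(** * The prime field inside [F] and the Frobenius map *)

Section PrimeEmb.

Variables (p : nat) (F : finFieldType).
Hypothesis pcharFp : p \in [pchar F].

Let p_pr : prime p := pcharf_prime pcharFp.

Lemma natr_modp m : (m %% p)%:R = m%:R :> F.
Proof.
by rewrite {2}(divn_eq m p) natrD natrM (pcharf0 pcharFp) mulr0 add0r.
Qed.

Lemma prime_embD (i j : 'F_p) :
  prime_emb F (i + j) = prime_emb F i + prime_emb F j.
Proof.
rewrite /prime_emb -natrD -[RHS]natr_modp /=.
(* Addition in ['F_p] reduces modulo an expression that equals [p] because [p] is prime. *)
by congr (_ %% _)%:R; apply: Fp_cast.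
Qed.

Lemma prime_emb0 : prime_emb F (0 : 'F_p) = 0.
Proof. by []. Qed.

Lemma prime_embN (i : 'F_p) : prime_emb F (- i) = - prime_emb F i.
Proof.
by apply/eqP; rewrite -addr_eq0 addrC -prime_embD subrr prime_emb0.
Qed.

Lemma prime_emb_inj : injective (@prime_emb p F).
Proof.
move=> i j /eqP; rewrite -subr_eq0 -prime_embN -prime_embD /prime_emb.
rewrite -(dvdn_pcharf pcharFp) => dv; apply/eqP; rewrite -subr_eq0.
have lt_p : (nat_of_ord (i - j)%R < p)%N.
  by apply: leq_trans (ltn_ord _) (eq_leq (Fp_cast p_pr)).
change (nat_of_ord (i - j)%R == 0%N); apply: contraLR lt_p.
by rewrite -lt0n -leqNgt => /dvdn_leq->.
Qed.

Lemma Fp_linear_frobenius k : Fp_linear p (fun x : F => x ^+ (p ^ k)).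
Proof.
split=> [x y|i x].
  rewrite exprDn_pchar // (eq_pnat _ (pcharf_eq pcharFp)).
  by rewrite pnatX pnat_id ?(pcharf_prime pcharFp).
rewrite exprMn; congr (_ * _); elim: k => [|k IH]; first by rewrite expr1.
by rewrite expnSr exprM IH -(pFrobenius_autE pcharFp) pFrobenius_aut_nat.
Qed.

(** The right side is monic of degree [p], and Frobenius fixes the [p] distinct prime field
    elements, so these are all its roots. *)
Lemma prod_XsubC_prime_emb :
  \prod_(i : 'F_p) ('X - (prime_emb F i)%:P) = 'X^p - 'X.
Proof.
have p_gt1 := prime_gt1 p_pr.
have szP : size ('X^p - 'X : {poly F}) = p.+1.
  by rewrite size_polyDl ?size_polyXn // size_polyN size_polyX ltnS.
have -> : \prod_(i : 'F_p) ('X - (prime_emb F i)%:P) =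
          \prod_(z <- map (@prime_emb p F) (enum 'F_p)) ('X - z%:P).
  by rewrite big_map big_enum.
rewrite [RHS](@all_roots_prod_XsubC _ _ (map (@prime_emb p F) (enum 'F_p))).
- rewrite lead_coefDl ?lead_coefXn ?scale1r //.
  by rewrite size_polyN size_polyX size_polyXn.
- by rewrite szP size_map -cardE card_Fp.
- apply/allP => _ /mapP[i _ ->]; rewrite rootE !hornerE subr_eq0.
  by rewrite -(pFrobenius_autE pcharFp) pFrobenius_aut_nat.
- by rewrite uniq_rootsE map_inj_uniq ?enum_uniq //; apply: prime_emb_inj.
Qed.

End PrimeEmb.

(** Logarithmic derivative with denominators cleared; outside [s] every factor [x - z] is
    invertible. *)
Lemma horner_deriv_prod_XsubC (F : fieldType) (s : seq F) (x : F) :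
  x \notin s ->
  (\prod_(z <- s) ('X - z%:P))^`().[x] =
  (\prod_(z <- s) ('X - z%:P)).[x] * \sum_(z <- s) (x - z)^-1.
Proof.
elim: s => [|z s IH]; first by rewrite !big_nil derivC !hornerE.
rewrite inE negb_or => /andP[nz ns].
rewrite !big_cons derivM !hornerE derivXsubC IH // !hornerE mulrDr.
by rewrite mulrAC mulfV ?subr_eq0 // mul1r.
Qed.

(** * Sums of inverses along prime field translates *)

Section InverseSum.

Variables (p : nat) (F : finFieldType).
Hypothesis pcharFp : p \in [pchar F].

Lemma sum_inv_prime_emb_shift (x : F) : x ^+ p != x ->
  (x ^+ p - x) * \sum_(i : 'F_p) (x + prime_emb F i)^-1 = -1.
Proof.
move=> nx; pose s := [seq prime_emb F i | i : 'F_p].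
have Ps : \prod_(z <- s) ('X - z%:P) = 'X^p - 'X :> {poly F}.
  by rewrite big_map big_enum /= prod_XsubC_prime_emb.
have ns : x \notin s.
  by rewrite -root_prod_XsubC Ps rootE !hornerE subr_eq0.
have := horner_deriv_prod_XsubC ns; rewrite Ps !derivE !hornerE.
(* In characteristic [p] the derivative of ['X^p - 'X] is [-1]. *)
rewrite hornerMn -mulr_natr (pcharf0 pcharFp) mulr0 sub0r => ->.
rewrite big_map big_enum /= (reindex_inj oppr_inj) /=; congr (_ * _).
by apply: eq_big => // i _; rewrite prime_embN.
Qed.

(* For x in the prime field the summands are the elements of the prime field
   (with 0^-1 = 0), and they cancel in pairs i, -i. *)
Lemma sum_inv_prime_emb_shift0 (x : F) : odd p -> x ^+ p = x ->
  \sum_(i : 'F_p) (x + prime_emb F i)^-1 = 0.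
Proof.
move=> p_odd ex.
have /codomP[j ->] : x \in codom (@prime_emb p F).
  rewrite -root_prod_XsubC big_map big_enum /= prod_XsubC_prime_emb //.
  by rewrite rootE !hornerE ex subrr.
pose S := \sum_(i : 'F_p) (prime_emb F i)^-1.
transitivity S.
  rewrite [RHS](reindex_inj (addrI j)) /=.
  by apply: eq_bigr => i _; rewrite prime_embD.
have SN : S = - S.
  rewrite {1}/S (reindex_inj oppr_inj) /= -sumrN.
  by apply: eq_bigr => i _; rewrite prime_embN // invrN.
(* Now [2 * S = 0], and 2 is invertible since [p] is odd. *)
apply/eqP; have := subrr S; rewrite {2}SN opprK -mulr2n -mulr_natr.
move/eqP; rewrite mulf_eq0 => /orP[//|].
rewrite -(dvdn_pcharf pcharFp).
rewrite dvdn_prime2 ?(pcharf_prime pcharFp) // => /eqP p2.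
by rewrite p2 in p_odd.
Qed.

Lemma card_sum_inv_prime_emb_shift (b : F) : odd p ->
  (#|[set x : F | (\sum_(i : 'F_p) (x + prime_emb F i)^-1 == b)%R]| <= p)%N.
Proof.
move=> p_odd; have p_gt1 := prime_gt1 (pcharf_prime pcharFp).
(* For [b = 0] the convention [0^-1 = 0] turns [q] into ['X^p - 'X], whose roots are the prime
   field. *)
pose q : {poly F} := 'X^p - ('X + (- b^-1)%:P).
have szq : size q = p.+1.
  by rewrite size_polyDl ?size_polyXn // size_polyN size_XaddC ltnS.
have nzq : q != 0 by rewrite -size_poly_gt0 szq.
suff sub : all (root q) (enum [set x : F |
    (\sum_(i : 'F_p) (x + prime_emb F i)^-1 == b)%R]).
  by have := max_poly_roots nzq sub (enum_uniq _); rewrite szq ltnS -cardE.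
apply/allP => x; rewrite mem_enum inE => /eqP Sx; rewrite rootE !hornerE.
have [ex|nx] := eqVneq (x ^+ p) x.
  by rewrite -Sx sum_inv_prime_emb_shift0 // invr0 ex oppr0 addr0 subrr.
have := sum_inv_prime_emb_shift nx; rewrite Sx => h.
have nb : b != 0.
  by apply: contraTneq (oner_neq0 F) => b0; rewrite -oppr_eq0 -h b0 mulr0 eqxx.
by rewrite opprD opprK addrA -[x ^+ p - x](mulfK nb) h mulN1r addNr.
Qed.

Lemma GAPN_inv : odd p -> GAPN p (fun x : F => x^-1).
Proof.
move=> p_odd a b nza.
(* The injection [x -> x / a] sends the fibre over [b] in direction [a] into the fibre over [a * b]
   in direction 1. *)
apply: leq_trans (card_sum_inv_prime_emb_shift (a * b) p_odd).
rewrite -(card_imset _ (mulIf (invr_neq0 nza))).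
apply/subset_leq_card/subsetP => _ /imsetP[x + ->]; rewrite !inE => /eqP <-.
rewrite mulr_sumr; apply/eqP/eq_bigr => i _.
by rewrite -[in LHS](mulfK nza (prime_emb F i)) -mulrDl invfM invrK mulrC.
Qed.

End InverseSum.

(** * From inversion to the monomials *)

Lemma GAPN_comp (p : nat) (F : finFieldType) (L f g : F -> F) :
  Fp_linear p L -> injective L -> g =1 L \o f -> GAPN p f -> GAPN p g.
Proof.
move=> [LD _] Linj eg hf a b nza; set A := [set x | _].
(* Additivity moves [L] out of the sum; injectivity then puts a nonempty fibre of [g] inside the
   fibre of [f] through any of its points [x0]. *)
have [->|[x0 x0A]] := set_0Vmem A; first by rewrite cards0.
have L0 : L 0 = 0 by apply: (addrI (L 0)); rewrite -LD !addr0.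
have eA x : \sum_(i : 'F_p) g (x + prime_emb F i * a) =
            L (\sum_(i : 'F_p) f (x + prime_emb F i * a)).
  by rewrite (big_morph L LD L0); apply: eq_bigr => i _; apply: eg.
apply: leq_trans (hf a (\sum_(i : 'F_p) f (x0 + prime_emb F i * a)) nza).
apply/subset_leq_card/subsetP => x; move: x0A; rewrite !inE !eA.
by move=> /eqP <- /eqP/Linj ->.
Qed.

Theorem proposition2p6 (p n : nat) (hp : prime p) (hodd : odd p)
    (hn : (1 <= n)%N) (F : finFieldType) (hF : #|F| = (p ^ n)%N)
    (d : nat) (hd : (d < p ^ n)%N)
    (hdeg : alg_degree p n (fun x : F => x ^+ d) = (n * (p - 1) - 1)%N) :
  EA_equivalent p (fun x : F => x ^+ d) (fun x : F => x ^+ (p ^ n - 2)) /\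
  GAPN p (fun x : F => x ^+ d).
Proof.
have pcharFp : p \in [pchar F] by apply: card_finPcharP hF hp.
have p_gt1 := prime_gt1 hp; have p_gt0 := prime_gt0 hp.
have p_gt2 : (2 < p)%N by rewrite odd_prime_gt2.
have [k lt_kn dk] : exists2 k, (k < n)%N & (d + p ^ k).+1 = (p ^ n)%N.
  apply: p_weight_submax => //; rewrite -(alg_degree_monomial hF hd) hdeg.
  by rewrite !subn1 prednK // muln_gt0 hn -ltnS prednK.
(* For [x != 0] this is [x ^+ (p ^ n - 1) = 1]; at 0 both sides vanish as both exponents are
   positive. It is used with [e = p ^ k] for [d] and with [e = 1] for [p ^ n - 2]. *)
have expVE m e : (0 < m)%N -> (0 < e)%N -> (m + e).+1 = (p ^ n)%N ->
    forall x : F, x ^+ m = x^-1 ^+ e.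
  move=> m0 e0 me x; have [->|nx] := eqVneq x 0.
    by rewrite invr0 !expr0n !gtn_eqF.
  apply: (mulIf (expf_neq0 e nx)); rewrite -exprD exprVn mulVf ?expf_neq0 //.
  by apply: (mulfI nx); rewrite -exprS me -hF expf_card mulr1.
have pn_gt2 : (2 < p ^ n)%N.
  by rewrite (leq_trans p_gt2) // -{1}[p]expn1 leq_exp2l.
(* [d = 0] would give [p ^ k + 1 = p ^ n], impossible by parity. *)
have d_gt0 : (0 < d)%N.
  rewrite lt0n; apply: contra_eqN dk => /eqP->; apply/eqP => /(congr1 odd).
  by rewrite /= !oddX hodd !orbT.
have pk_gt0 : (0 < p ^ k)%N by rewrite expn_gt0 p_gt0.
have frobK m : (m <= n)%N ->
    cancel (fun x : F => x ^+ (p ^ m)) (fun x => x ^+ (p ^ (n - m))).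
  by move=> le_mn x; rewrite -exprM -expnD subnKC // -hF expf_card.
have frob_bij m : (m <= n)%N -> bijective (fun x : F => x ^+ (p ^ m)).
  by move=> le_mn; apply: injF_bij; apply: can_inj (frobK m le_mn).
have frob_lin := Fp_linear_frobenius pcharFp.
split; last first.
  apply: (GAPN_comp (L := fun x => x ^+ (p ^ k)) (f := fun x => x^-1)) => //.
  - exact/bij_inj/frob_bij/ltnW.
  - exact: expVE.
  - exact: GAPN_inv.
(* [x ^+ d] is the [k]-th Frobenius iterate of [x^-1]; the iterate of order [n - k] undoes it. *)
exists (fun x => x ^+ (p ^ (n - k))), id, (fun=> 0); split.
- split; last exact/frob_bij/leq_subr.
  by exists (fun x => x ^+ (p ^ (n - k))), 0; split=> // x; rewrite addr0.
- split; last by exists id.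
  by exists id, 0; split=> // x; rewrite addr0.
- exists (fun=> 0), 0; split=> [|x]; last by rewrite addr0.
  by split=> *; rewrite ?addr0 ?mulr0.
move=> x; rewrite addr0 (expVE d (p ^ k)%N) // (frobK k (ltnW lt_kn)).
rewrite (expVE _ 1%N) ?expr1 ?subn_gt0 // addn1.
by rewrite subn2; case: (p ^ n)%N pn_gt2 => [|[|[]]].
Qed.
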